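(* Let $K$ be a field and let $A=K[a_1,\ldots,a_n]$ be a finitely generated $K$-algebra with the PBW basis $\mathcal{B}=\{a^{\alpha}=a_1^{\alpha_1}\cdots a_n^{\alpha_n}\mid \alpha=(\alpha_1,\ldots,\alpha_n)\in\mathbb{N}^n\}$. The following statements are equivalent. (i) $A$ is a solvable polynomial algebra with a graded monomial ordering with respect to a certain positive-degree function, that is, there are a positive-degree function $d(\ )$ on $\mathcal{B}$ and a graded monomial ordering $\prec_{gr}$ on $\mathcal{B}$ with respect to $d(\ )$ such that $A$ is a solvable polynomial algebra with admissible system $(\mathcal{B},\prec_{gr})$. (ii) $A$ is an $\mathbb{N}$-filtered solvable polynomial algebra of $(\mathcal{B},d(\ ))$-type, that is, $A$ is a solvable polynomial algebra with respect to $\mathcal{B}$ and some monomial ordering $\prec$ on $\mathcal{B}$, and $A$ is an $\mathbb{N}$-filtered algebra of $(\mathcal{B},d(\ ))$-type for some positive-degree function $d(\ )$ on $\mathcal{B}$.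
   Context: Conventions: algebras are associative with $1$; $\mathbb{N}=\{0,1,2,\ldots\}$; $K^*=K\setminus\{0\}$. $A=K[a_1,\ldots,a_n]$ denotes a (not necessarily commutative) $K$-algebra generated by $a_1,\ldots,a_n$. That $\mathcal{B}$ is a PBW basis of $A$ means that the elements $a^{\alpha}$, $\alpha\in\mathbb{N}^n$, are pairwise distinct and form a $K$-basis of $A$. Leading monomial: given a total ordering $\prec$ on $\mathcal{B}$ and a nonzero $f=\sum_s\lambda_sa^{\alpha(s)}$ with $\lambda_s\in K^*$ and distinct $a^{\alpha(s)}\in\mathcal{B}$, $\mathbf{LM}(f)$ is the $\prec$-largest of the $a^{\alpha(s)}$; set $\mathbf{LM}(0)=0$. (Two-sided) monomial ordering on $\mathcal{B}$: a total well-ordering $\prec$ on $\mathcal{B}$ such that (1) for $a^{\alpha},a^{\beta},a^{\eta}\in\mathcal{B}$, if $\mathbf{LM}(a^{\alpha}a^{\beta}a^{\eta})\notin\{0,1\}$ and $a^{\beta}\ne\mathbf{LM}(a^{\alpha}a^{\beta}a^{\eta})$, then $a^{\beta}\prec\mathbf{LM}(a^{\alpha}a^{\beta}a^{\eta})$; (2) for $a^{\gamma},a^{\alpha},a^{\beta},a^{\eta}\in\mathcal{B}$, if $a^{\alpha}\prec a^{\beta}$, $\mathbf{LM}(a^{\gamma}a^{\alpha}a^{\eta})\neq 0$ and $\mathbf{LM}(a^{\gamma}a^{\beta}a^{\eta})\notin\{0,1\}$, then $\mathbf{LM}(a^{\gamma}a^{\alpha}a^{\eta})\prec\mathbf{LM}(a^{\gamma}a^{\beta}a^{\eta})$.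 Solvable polynomial algebra: $A$ with PBW basis $\mathcal{B}$ and a monomial ordering $\prec$ on $\mathcal{B}$ such that for all $a^{\alpha},a^{\beta}\in\mathcal{B}$, $a^{\alpha}a^{\beta}=\lambda_{\alpha,\beta}a^{\alpha+\beta}+f_{\alpha,\beta}$, where $\lambda_{\alpha,\beta}\in K^*$, $a^{\alpha+\beta}=a_1^{\alpha_1+\beta_1}\cdots a_n^{\alpha_n+\beta_n}$, $f_{\alpha,\beta}\in A$, and either $f_{\alpha,\beta}=0$ or $\mathbf{LM}(f_{\alpha,\beta})\prec a^{\alpha+\beta}$. Then $(\mathcal{B},\prec)$ is called an admissible system of $A$. Positive-degree function: a function $d(\ )$ on $\mathcal{B}$ given by an $n$-tuple $(m_1,\ldots,m_n)$ of positive integers via $d(a^{\alpha})=\sum_{i=1}^n\alpha_im_i$ (so $d(a_i)=m_i$); it is extended to nonzero $f=\sum_s\lambda_sa^{\alpha(s)}$ ($\lambda_s\in K^*$, distinct $a^{\alpha(s)}$) by $d(f)=\max_sd(a^{\alpha(s)})$. Graded monomial ordering: if $A$ is a solvable polynomial algebra with admissible system $(\mathcal{B},\prec)$, then $\prec$ is a graded monomial ordering with respect to the positive-degree function $d(\ )$ if for all $a^{\alpha},a^{\beta}\in\mathcal{B}$, $a^{\alpha}\prec a^{\beta}$ implies $d(a^{\alpha})\le d(a^{\beta})$. $\mathbb{N}$-filtered algebra of $(\mathcal{B},d(\ ))$-type: for the positive-degree function $d(\ )$, setting $F_pA=K\text{-span}\{a^{\alpha}\in\mathcal{B}\mid d(a^{\alpha})\le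 p\}$ for $p\in\mathbb{N}$, one has $F_pA\,F_qA\subseteq F_{p+q}A$ for all $p,q\in\mathbb{N}$. *)

(* Defs.v *)
From mathcomp Require Import all_boot all_order all_algebra.
From mathcomp Require Import boolp classical_sets.

Set Implicit Arguments.
Unset Strict Implicit.
Unset Printing Implicit Defensive.

Import GRing.Theory.
Local Open Scope classical_set_scope.
Local Open Scope ring_scope.

(* Exponent vectors in N^n, added componentwise through the nmodType structure
   of finite functions. *)
Notation exponent n := {ffun 'I_n -> nat}.

Definition kspan (K : fieldType) (A : algType K) (S : set A) : set A :=
  [set f | exists (s : seq A) (c : A -> K),
     (forall x, x \in s -> S x) /\ f = \sum_(x <- s) c x *: x].

Section PBW.
Variables (K : fieldType) (A : algType K) (n : nat) (a : 'I_n -> A).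

(* The factors of the (noncommutative) product come in increasing order of i. *)
Definition mon (alpha : exponent n) : A := \prod_(i < n) a i ^+ alpha i.

Definition monomials : set A := range mon.

Definition PBW_basis : Prop :=
  [/\ injective mon,
      kspan monomials = [set: A] &
      forall (s : seq (exponent n)) (c : exponent n -> K), uniq s ->
        \sum_(alpha <- s) c alpha *: mon alpha = 0 ->
        forall alpha, alpha \in s -> c alpha = 0].

Section Ordering.
(* A strict ordering on the set of monomials: its values at pairs of elements of
   A that are not both monomials are irrelevant. *)
Variable lt : A -> A -> Prop.

Definition total_well_ordering : Prop :=
  [/\ forall x, monomials x -> ~ lt x x,
      forall x y z, monomials x -> monomials y -> monomials z ->
        lt x y -> lt y z -> lt x z,
      forall x y, monomials x -> monomials y -> [\/ lt x y, x = y | lt y x] &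
      forall S : set A, S `<=` monomials -> S !=set0 ->
        exists2 x, S x & forall y, S y -> x = y \/ lt x y].

Definition is_LM (f x : A) : Prop :=
  exists (s : seq (exponent n)) (c : exponent n -> K) (alpha : exponent n),
    [/\ uniq s /\ (forall beta, beta \in s -> c beta != 0),
        f = \sum_(beta <- s) c beta *: mon beta,
        alpha \in s /\ x = mon alpha &
        forall beta, beta \in s -> beta != alpha -> lt (mon beta) (mon alpha)].

(* For a PBW basis, 0 has only the empty expansion, so that LM 0 = 0. *)
Definition LM (f : A) : A := xget 0 [set x | is_LM f x].

Definition monomial_ordering : Prop :=
  [/\ total_well_ordering,
      forall alpha beta eta : exponent n,
        let u := LM (mon alpha * mon beta * mon eta) in
        u <> 0 -> u <> 1 -> mon beta <> u -> lt (mon beta) u &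
      forall gamma alpha beta eta : exponent n,
        let u := LM (mon gamma * mon alpha * mon eta) in
        let v := LM (mon gamma * mon beta * mon eta) in
        lt (mon alpha) (mon beta) -> u <> 0 -> v <> 0 -> v <> 1 -> lt u v].

Definition solvable_polynomial_algebra : Prop :=
  [/\ PBW_basis, monomial_ordering &
      forall alpha beta : exponent n, exists (lambda : K) (f : A),
        [/\ lambda != 0,
            mon alpha * mon beta = lambda *: mon (alpha + beta) + f &
            f = 0 \/ lt (LM f) (mon (alpha + beta))]].

End Ordering.

Definition positive_weights (m : 'I_n -> nat) : Prop :=
  forall i, (0 < m i)%N.

(* The value d(a^alpha) of the degree function of weights m; by injectivity of
   mon on a PBW basis, d is defined on exponents. *)
Definition deg (m : 'I_n -> nat) (alpha : exponent n) : nat :=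
  (\sum_(i < n) alpha i * m i)%N.

Definition graded_monomial_ordering (m : 'I_n -> nat) (lt : A -> A -> Prop) :
    Prop :=
  monomial_ordering lt /\
  forall alpha beta : exponent n,
    lt (mon alpha) (mon beta) -> (deg m alpha <= deg m beta)%N.

Definition filtration (m : 'I_n -> nat) (p : nat) : set A :=
  kspan [set mon alpha | alpha in [set alpha | (deg m alpha <= p)%N]].

Definition N_filtered (m : 'I_n -> nat) : Prop :=
  forall p q : nat,
    kspan [set x * y | x in filtration m p & y in filtration m q]
      `<=` filtration m (p + q)%N.

End PBW.

(* Main.v *)
Require Import Defs.
From mathcomp Require Import all_boot all_order all_algebra.
From mathcomp Require Import boolp classical_sets.

(** Everything rests on reading the solvability axiom as a statement about
    spans: modulo the span of the monomials below [a^(alpha + beta)], the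
    product [a^alpha a^beta] is a nonzero multiple of [a^(alpha + beta)]
    ([mul_mon_below]).

    From (i) to (ii): a graded ordering has only monomials of degree at most
    [d(alpha + beta) = d(alpha) + d(beta)] below [a^(alpha + beta)], so the
    product lies in the filtration piece of that degree.

    From (ii) to (i): compare monomials by degree first and break ties with the
    given ordering ([graded_lt]).  By the filtration axiom the tail of
    [a^alpha a^beta] involves only monomials of degree at most
    [d(alpha + beta)]; by solvability it involves only monomials below
    [a^(alpha + beta)] for the given ordering.  Uniqueness of expansions in the
    basis lets both bounds hold at once for every monomial of the tail
    ([span_setI]), and together they say that the tail is below
    [a^(alpha + beta)] for the new ordering.  It remains to see that the new
    ordering is a monomial ordering.  For an ordering that is compatible with
    the addition of exponents, a triple product
    [a^alpha a^beta a^eta] has leading monomial [a^(alpha + beta + eta)]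
    ([LM_mul3]), so that both axioms of a monomial ordering become statements
    about exponents.  Compatibility of the new ordering follows from that of
    the given one ([lt_mon_addr]) and the additivity of the degree. *)

Set Implicit Arguments.
Unset Strict Implicit.
Unset Printing Implicit Defensive.

Import GRing.Theory.
Local Open Scope classical_set_scope.
Local Open Scope ring_scope.

(** * Linear spans *)

Lemma big_uniq_extend (T : eqType) (V : nmodType) (s t : seq T) (F : T -> V) :
  uniq s -> uniq t -> {subset s <= t} ->
  \sum_(x <- t) (if x \in s then F x else 0) = \sum_(x <- s) F x.
Proof.
move=> us ut st; rewrite -big_mkcond -big_filter; apply/perm_big/uniq_perm => //.
  exact: filter_uniq.
by move=> x; rewrite mem_filter; case xs: (x \in s) => //=; rewrite st.
Qed.

Section Span.
Variables (K : fieldType) (A : algType K).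
Implicit Types (S T U : set A) (f g : A).

(** The list in the definition of [kspan] may repeat vectors; collecting the
    repetitions and dropping the zero terms gives a reduced expression. *)
Lemma kspan_reduced S f : kspan S f ->
  exists (s : seq A) (c : A -> K),
    [/\ uniq s, forall x, x \in s -> S x, forall x, x \in s -> c x != 0 &
        f = \sum_(x <- s) c x *: x].
Proof.
move=> [s [c [sS ->]]]; pose c' x := c x *+ count_mem x s.
exists [seq x <- undup s | c' x != 0], c'; split.
- by rewrite filter_uniq // undup_uniq.
- by move=> x; rewrite mem_filter mem_undup => /andP[_ /sS].
- by move=> x; rewrite mem_filter => /andP[].
rewrite -big_undup_iterop_count big_filter [RHS]big_mkcond /=.
apply: eq_bigr => x _; rewrite Monoid.iteropE iter_addr_0 scalerMnl -/(c' x).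
by case: eqP => [->|//]; rewrite scale0r.
Qed.

Lemma kspan0 S : kspan S 0.
Proof. by exists [::], (fun=> 0); rewrite big_nil. Qed.

Lemma mem_kspan S x : S x -> kspan S x.
Proof.
move=> Sx; exists [:: x], (fun=> 1); split; last by rewrite big_seq1 scale1r.
by move=> y; rewrite inE => /eqP ->.
Qed.

Lemma kspanZ S k f : kspan S f -> kspan S (k *: f).
Proof.
move=> [s [c [sS ->]]]; exists s, (fun x => k * c x); split => //.
by rewrite scaler_sumr; apply: eq_bigr => x _; rewrite scalerA.
Qed.

Lemma kspanD S f g : kspan S f -> kspan S g -> kspan S (f + g).
Proof.
move=> /kspan_reduced[s [c [us sS _ ->]]] /kspan_reduced[t [d [ut tS _ ->]]].
exists (undup (s ++ t)),
  (fun x => (if x \in s then c x else 0) + (if x \in t then d x else 0)).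
split=> [x|]; first by rewrite mem_undup mem_cat => /orP[/sS|/tS].
have sub r : (forall x, x \in r -> x \in s ++ t) ->
    {subset r <= undup (s ++ t)} by move=> rst x /rst; rewrite mem_undup.
rewrite -(@big_uniq_extend _ _ s (undup (s ++ t))) ?undup_uniq //; last first.
  by apply: sub => x xs; rewrite mem_cat xs.
rewrite -(@big_uniq_extend _ _ t (undup (s ++ t))) ?undup_uniq //; last first.
  by apply: sub => x xt; rewrite mem_cat xt orbT.
rewrite -big_split /=; apply: eq_bigr => x _; rewrite scalerDl.
by congr (_ + _); case: ifP; rewrite // scale0r.
Qed.

Lemma kspanB S f g : kspan S f -> kspan S g -> kspan S (f - g).
Proof. by move=> Sf Sg; rewrite -scaleN1r; apply/kspanD/kspanZ. Qed.

Lemma kspan_sub S T f : S `<=` kspan T -> kspan S f -> kspan T f.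
Proof.
move=> ST [s [c [sS ->]]]; rewrite big_seq.
apply: (big_ind (kspan T)) => [|x y|x xs]; first exact: kspan0.
  exact: kspanD.
exact/kspanZ/ST/sS.
Qed.

Lemma kspan_mul S T U f g :
  (forall x y, S x -> T y -> kspan U (x * y)) ->
  kspan S f -> kspan T g -> kspan U (f * g).
Proof.
move=> STU [s [c [sS ->]]] [t [d [tT ->]]]; rewrite big_distrlr /= big_seq.
apply: (big_ind (kspan U)) => [|x y|x xs]; [exact: kspan0|exact: kspanD|].
rewrite big_seq.
apply: (big_ind (kspan U)) => [|y z|y yt]; [exact: kspan0|exact: kspanD|].
rewrite -scalerAl -scalerAr; apply/kspanZ/kspanZ/STU; [exact: sS | exact: tT].
Qed.

End Span.

(** * Expansions in a PBW basis *)

Section PBWBasis.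
Variables (K : fieldType) (A : algType K) (n : nat) (a : 'I_n -> A).
Hypothesis hB : PBW_basis a.
Implicit Types (P Q : set (exponent n)) (f : A) (alpha beta : exponent n).

Local Notation mon := (mon a).
Local Notation span P := (kspan (mon @` P)).

Lemma mon_inj : injective mon.
Proof. by case: hB. Qed.

Lemma mon0 : mon 0 = 1.
Proof. by rewrite /Defs.mon big1 // => i _; rewrite ffunE; apply: expr0. Qed.

Lemma mon_neq0 alpha : mon alpha <> 0.
Proof.
move=> m0; case: hB => _ _ /(_ [:: alpha] (fun=> 1) isT).
rewrite big_seq1 scale1r => /(_ m0 alpha (mem_head _ _)) /eqP.
by rewrite oner_eq0.
Qed.

Definition expansion f (s : seq (exponent n)) (c : exponent n -> K) : Prop :=
  [/\ uniq s, forall beta, beta \in s -> c beta != 0 &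
      f = \sum_(beta <- s) c beta *: mon beta].

Lemma span_expansion P f : span P f ->
  exists s c, expansion f s c /\ forall beta, beta \in s -> P beta.
Proof.
move=> /kspan_reduced[s [c [us sP c0 ->]]].
have pre x : exists b, x \in s -> P b /\ mon b = x.
  by have [/sP [b Pb <-]|_] := boolP (x \in s); [exists b | exists 0].
have [e eP] := choice pre.
have sE : map mon (map e s) = s.
  by rewrite -map_comp -[RHS]map_id; apply/eq_in_map => x /eP[].
exists (map e s), (c \o mon); split; last by move=> b /mapP[x /eP[? _] ->].
split; first by apply: (@map_uniq _ _ mon); rewrite sE.
  by move=> b /mapP[x xs ->] /=; rewrite (eP _ xs).2 c0.
by rewrite -[in LHS]sE big_map.
Qed.

Lemma expansion_span P f s c :
  expansion f s c -> (forall beta, beta \in s -> P beta) -> span P f.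
Proof.
move=> [_ _ ->] sP; rewrite big_seq.
apply: (big_ind (kspan _)) => [|x y|b bs]; first exact: kspan0.
  exact: kspanD.
by apply/kspanZ/mem_kspan; exists b => //; apply: sP.
Qed.

Lemma expansion_exists f : exists s c, expansion f s c.
Proof.
have [_ spanT _] := hB; have : span setT f by rewrite [kspan _]spanT.
by move=> /span_expansion[s [c [? _]]]; exists s, c.
Qed.

(** The difference of the two expansions is a vanishing combination of
    monomials; a monomial occurring in only one of them would have a nonzero
    coefficient there. *)
Lemma expansion_sub f s c t d :
  expansion f s c -> expansion f t d -> {subset s <= t}.
Proof.
move=> [us c0 fs] [ut d0 ft] b bs; apply/negPn/negP => bt.
have [_ _ free] := hB; pose r := undup (s ++ t).
pose e x := (if x \in s then c x else 0) - (if x \in t then d x else 0).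
have sr : {subset s <= r} by move=> x xs; rewrite mem_undup mem_cat xs.
have tr : {subset t <= r} by move=> x xt; rewrite mem_undup mem_cat xt orbT.
have e0 : \sum_(x <- r) e x *: mon x = 0.
  transitivity (f - f); last exact: subrr.
  rewrite [in RHS](_ : f - f = \sum_(x <- s) c x *: mon x
    - \sum_(x <- t) d x *: mon x); last by rewrite -fs -ft.
  rewrite -(big_uniq_extend _ us (undup_uniq _) sr).
  rewrite -(big_uniq_extend _ ut (undup_uniq _) tr) -sumrB.
  apply: eq_bigr => x _; rewrite scalerBl.
  by congr (_ - _); case: ifP; rewrite // scale0r.
have := free _ _ (undup_uniq _) e0 b (sr _ bs).
by rewrite /e bs (negbTE bt) subr0; apply/eqP/c0.
Qed.

Lemma span_setI P Q f : span P f -> span Q f -> span (P `&` Q) f.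
Proof.
move=> /span_expansion[s [c [fs sP]]] /span_expansion[t [d [ft tQ]]].
apply: (expansion_span fs) => b bs; split; first exact: sP.
exact/tQ/(expansion_sub fs ft).
Qed.

(** * Leading monomials *)

Section LeadingMonomial.
Variable lt : A -> A -> Prop.
Hypothesis ho : total_well_ordering a lt.

Local Notation LM := (LM a lt).

Definition below alpha : set (exponent n) :=
  [set beta | lt (mon beta) (mon alpha)].

Lemma lt_mon_irr alpha : ~ lt (mon alpha) (mon alpha).
Proof. by case: ho => irr _ _ _; apply: irr; exists alpha. Qed.

Lemma lt_mon_trans alpha beta gamma :
  lt (mon alpha) (mon beta) -> lt (mon beta) (mon gamma) ->
  lt (mon alpha) (mon gamma).
Proof. by case: ho => _ tr _ _; apply: tr; eexists. Qed.

Lemma lt_mon_total alpha beta : alpha != beta ->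
  lt (mon alpha) (mon beta) \/ lt (mon beta) (mon alpha).
Proof.
move=> ab; case: ho => _ _ tot _.
case: (tot (mon alpha) (mon beta)); first by exists alpha.
- by exists beta.
- by left.
- by move=> /mon_inj abE; rewrite abE eqxx in ab.
- by right.
Qed.

Lemma seq_max_mon (s : seq (exponent n)) : s != [::] ->
  exists2 alpha, alpha \in s &
    forall beta, beta \in s -> beta != alpha -> lt (mon beta) (mon alpha).
Proof.
elim: s => [//|g s IH] _; have [->|/IH[al als al_max]] := eqVneq s [::].
  by exists g; rewrite ?mem_head // => b; rewrite inE => ->.
have [gal|gal] := eqVneq g al.
  exists al; first by rewrite inE als orbT.
  by move=> b; rewrite inE gal => /orP[->|/al_max].
have [g_al|al_g] := lt_mon_total gal.
  exists al; first by rewrite inE als orbT.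
  by move=> b; rewrite inE => /orP[/eqP->|/al_max].
exists g; first exact: mem_head.
move=> b; rewrite inE => /orP[->//|bs] _.
have [->//|/(al_max _ bs) b_al] := eqVneq b al.
exact: lt_mon_trans b_al al_g.
Qed.

(** Two expansions of [f] involve the same monomials, hence have the same
    largest one. *)
Lemma is_LM_unique f x y : is_LM a lt f x -> is_LM a lt f y -> x = y.
Proof.
move=> [s [c [al [[us c0] fs [als ->] al_max]]]].
move=> [t [d [be [[ut d0] ft [bet ->] be_max]]]].
have st : {subset s <= t} by apply: (@expansion_sub f s c t d).
have ts : {subset t <= s} by apply: (@expansion_sub f t d s c).
have [->//|ab] := eqVneq al be.
have lab := be_max _ (st _ als) ab.
rewrite eq_sym in ab; have lba := al_max _ (ts _ bet) ab.
by case: (@lt_mon_irr al); apply: lt_mon_trans lab lba.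
Qed.

Lemma is_LM_LM f x : is_LM a lt f x -> LM f = x.
Proof.
move=> fx; apply: (is_LM_unique _ fx).
by apply: (@xgetPex _ 0 [set y | is_LM a lt f y]); exists x.
Qed.

Lemma expansion_is_LM f s c alpha : expansion f s c -> alpha \in s ->
  (forall beta, beta \in s -> beta != alpha -> lt (mon beta) (mon alpha)) ->
  is_LM a lt f (mon alpha).
Proof. by move=> [us c0 fs] als al_max; exists s, c, alpha. Qed.

(** Being a combination of smaller monomials is the form in which the
    condition on the tail of a product composes with linear operations. *)
Lemma span_belowP alpha f :
  (f = 0 \/ lt (LM f) (mon alpha)) <-> span (below alpha) f.
Proof.
split=> [[->|]|]; first exact: kspan0.
- have [s [c fs]] := expansion_exists f.
  have [s0|/seq_max_mon[be bes be_max]] := eqVneq s [::].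
    by case: fs => _ _ ->; rewrite s0 big_nil => _; apply: kspan0.
  rewrite (is_LM_LM (expansion_is_LM fs bes be_max)) => be_al.
  apply: (expansion_span fs) => b bs.
  have [->//|/(be_max _ bs) b_be] := eqVneq b be.
  exact: lt_mon_trans b_be be_al.
- move=> /span_expansion[s [c [fs sal]]].
  have [s0|/seq_max_mon[be bes be_max]] := eqVneq s [::].
    by left; case: fs => _ _ ->; rewrite s0 big_nil.
  by right; rewrite (is_LM_LM (expansion_is_LM fs bes be_max)); apply: sal.
Qed.

(** This says that [f] has leading monomial [mon alpha], without mentioning
    [LM]: the form in which leading terms can be multiplied. *)
Definition leads f alpha : Prop :=
  exists2 lambda : K, lambda != 0 & span (below alpha) (f - lambda *: mon alpha).

Lemma leads_LM f alpha : leads f alpha -> LM f = mon alpha.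
Proof.
move=> [k k0 /span_expansion[s [c [[us c0 fs] sal]]]].
have als : alpha \notin s by apply/negP => /sal /lt_mon_irr.
have neq b : b \in s -> (b == alpha) = false.
  by move=> bs; apply/negP => /eqP bE; rewrite -bE bs in als.
apply/is_LM_LM/(@expansion_is_LM _ (alpha :: s)
    (fun b => if b == alpha then k else c b)).
- split=> [|b|]; first by rewrite /= als.
    by rewrite inE; case: eqP => //= _; apply: c0.
  rewrite big_cons eqxx -[LHS](subrK (k *: mon alpha)) addrC fs; congr (_ + _).
  by apply: eq_big_seq => b /neq ->.
- exact: mem_head.
- by move=> b; rewrite inE => /orP[->//|/sal].
Qed.

Lemma mul_mon_below :
  (forall alpha beta, exists (lambda : K) (f : A),
     [/\ lambda != 0, mon alpha * mon beta = lambda *: mon (alpha + beta) + f &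
         f = 0 \/ lt (LM f) (mon (alpha + beta))]) <->
  (forall alpha beta, leads (mon alpha * mon beta) (alpha + beta)).
Proof.
split=> h al be.
  have [k [f [k0 -> /span_belowP fP]]] := h al be.
  by exists k => //; rewrite addrAC subrr add0r.
have [k k0 kP] := h al be; exists k, (mon al * mon be - k *: mon (al + be)).
by split => //; [rewrite addrCA subrr addr0 | apply/span_belowP].
Qed.

(** * Products of monomials *)

Section Products.
Hypothesis mulP : forall alpha beta, leads (mon alpha * mon beta) (alpha + beta).

Lemma LM_mul alpha beta : LM (mon alpha * mon beta) = mon (alpha + beta).
Proof. exact/leads_LM/mulP. Qed.

(** Multiplying the tail of [a^alpha a^beta] by [a^eta] keeps it below
    [a^(alpha + beta + eta)] as soon as adding [eta] preserves the ordering. *)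
Lemma LM_mul3 (addP : forall alpha beta eta,
    lt (mon alpha) (mon beta) -> lt (mon (alpha + eta)) (mon (beta + eta)))
    alpha beta eta :
  LM (mon alpha * mon beta * mon eta) = mon (alpha + beta + eta).
Proof.
apply: leads_LM; have [k k0 kP] := mulP alpha beta.
have [l l0 lP] := mulP (alpha + beta) eta.
exists (k * l); first exact: mulf_neq0.
have -> : mon alpha * mon beta * mon eta - (k * l) *: mon (alpha + beta + eta) =
    (mon alpha * mon beta - k *: mon (alpha + beta)) * mon eta
    + k *: (mon (alpha + beta) * mon eta - l *: mon (alpha + beta + eta)).
  by rewrite mulrBl scalerBr scalerA -scalerAl addrA subrK.
apply: kspanD; last exact: kspanZ.
apply: kspan_mul kP (mem_kspan (erefl : [set mon eta] (mon eta))).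
move=> _ _ [g g_ab <-] ->; have [j _ jP] := mulP g eta.
rewrite -[X in kspan _ X](subrK (j *: mon (g + eta))).
have g_abe : lt (mon (g + eta)) (mon (alpha + beta + eta)) by apply: addP.
apply: kspanD; last by apply/kspanZ/mem_kspan; exists (g + eta).
apply: kspan_sub jP => y [b b_g <-]; apply: mem_kspan; exists b => //.
exact: lt_mon_trans b_g g_abe.
Qed.

Lemma mon_eq1 alpha : mon alpha = 1 -> alpha = 0.
Proof. by rewrite -mon0 => /mon_inj. Qed.

Lemma lt_mon0 (hm : monomial_ordering a lt) alpha :
  alpha != 0 -> lt (mon 0) (mon alpha).
Proof.
move=> al0; have [_ /(_ alpha 0 0) /= + _] := hm.
have -> : LM (mon alpha * mon 0 * mon 0) = mon alpha.
  by rewrite -mulrA {1}mon0 mul1r LM_mul addr0.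
apply; first exact: mon_neq0.
  by move=> /mon_eq1/eqP; apply/negP.
by move=> /mon_inj/esym/eqP; apply/negP.
Qed.

(** The second axiom of a monomial ordering, with trivial left factor, is
    compatibility with addition, except for the case where the larger product
    has leading monomial [1]; that case is void since [1] is the smallest
    monomial. *)
Lemma lt_mon_addr (hm : monomial_ordering a lt) alpha beta eta :
  lt (mon alpha) (mon beta) -> lt (mon (alpha + eta)) (mon (beta + eta)).
Proof.
move=> lab; have [_ _ /(_ 0 alpha beta eta)] := hm.
rewrite /= mon0 !mul1r !LM_mul; apply => //; try exact: mon_neq0.
move=> /mon_eq1 be0.
have b0 : beta = 0.
  apply/ffunP => i; move/ffunP/(_ i): be0; rewrite !ffunE => /eqP.
  by rewrite addn_eq0 => /andP[/eqP].
have [aE|/(lt_mon0 hm)] := eqVneq alpha 0.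
  by rewrite aE b0 in lab; case: (lt_mon_irr lab).
by rewrite b0 in lab => /lt_mon_trans /(_ lab) /lt_mon_irr.
Qed.

End Products.

End LeadingMonomial.

(** * Degrees and the graded ordering *)

Section Graded.
Variable m : 'I_n -> nat.

Local Notation deg := (deg m).

Lemma degD alpha beta : deg (alpha + beta) = (deg alpha + deg beta)%N.
Proof.
rewrite /Defs.deg -big_split /=; apply: eq_bigr => i _.
by rewrite ffunE; apply: mulnDl.
Qed.

Lemma deg_eq0 (hm : positive_weights m) alpha : (deg alpha == 0%N) = (alpha == 0).
Proof.
apply/idP/eqP => [|->]; last by rewrite /Defs.deg big1 // => i _; rewrite ffunE.
rewrite sum_nat_eq0 => /forallP al0; apply/ffunP => i; rewrite ffunE.
by have := al0 i; rewrite muln_eq0 -[m i == _]negbK -lt0n hm orbF => /eqP.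
Qed.

Lemma N_filtered_mul_mon alpha beta : N_filtered a m ->
  filtration a m (deg alpha + deg beta) (mon alpha * mon beta).
Proof.
move=> hF; apply: (hF (deg alpha) (deg beta)); apply: mem_kspan.
exists (mon alpha); first by apply: mem_kspan; exists alpha => /=.
by exists (mon beta) => //; apply: mem_kspan; exists beta => /=.
Qed.

Lemma mul_mon_N_filtered :
  (forall alpha beta,
     filtration a m (deg alpha + deg beta) (mon alpha * mon beta)) ->
  N_filtered a m.
Proof.
move=> h p q f; apply: kspan_sub => _ [x xp [y yq <-]].
apply: kspan_mul xp yq => _ _ [al /= alp <-] [be /= beq <-].
apply: kspan_sub (h al be) => _ [b /= bD <-]; apply: mem_kspan; exists b => //=.
exact/(leq_trans bD)/leq_add.
Qed.

(** Along a graded ordering every monomial of the tail of a product has degree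
    at most that of the leading one. *)
Lemma graded_N_filtered lt : graded_monomial_ordering a m lt ->
  solvable_polynomial_algebra a lt -> N_filtered a m.
Proof.
move=> [_ gr] [_ [ho _ _] /(mul_mon_below ho) mulP].
apply: mul_mon_N_filtered => al be; rewrite -degD.
have [k _ kP] := mulP al be.
rewrite -[X in filtration _ _ _ X](subrK (k *: mon (al + be))).
apply: kspanD; last by apply/kspanZ/mem_kspan; exists (al + be) => /=.
apply: kspan_sub kP => _ [b b_ab <-]; apply: mem_kspan; exists b => //=.
exact: gr.
Qed.

Section GradedOrder.
Variable lt : A -> A -> Prop.
Hypothesis m_gt0 : positive_weights m.

(** Orderings are relations on the whole of [A] here, so the degree is read off
    from an exponent of each side; injectivity of [mon] makes it well defined
    ([graded_ltE]). *)
Definition graded_lt (x y : A) : Prop :=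
  exists alpha beta, [/\ x = mon alpha, y = mon beta &
    (deg alpha < deg beta)%N \/
    deg alpha = deg beta /\ lt (mon alpha) (mon beta)].

Lemma graded_ltE alpha beta : graded_lt (mon alpha) (mon beta) <->
  (deg alpha < deg beta)%N \/
  deg alpha = deg beta /\ lt (mon alpha) (mon beta).
Proof.
by split=> [[al [be [/mon_inj-> /mon_inj->]]]//|h]; exists alpha, beta.
Qed.

Lemma graded_lt_deg alpha beta :
  graded_lt (mon alpha) (mon beta) -> (deg alpha <= deg beta)%N.
Proof. by move=> /graded_ltE[/ltnW|[->]]. Qed.

(** For well-foundedness: a nonempty set of monomials has elements of least
    degree, and among those one that is least for [lt]. *)
Lemma graded_lt_well_ordering :
  total_well_ordering a lt -> total_well_ordering a graded_lt.
Proof.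
move=> ho; split.
- move=> _ [al _ <-] /graded_ltE[|[_ /(lt_mon_irr ho)]//].
  by rewrite ltnn.
- move=> _ _ _ [al _ <-] [be _ <-] [ga _ <-] /graded_ltE ab /graded_ltE bg.
  apply/graded_ltE; case: ab bg => [ab|[-> ab]] [bg|[<- bg]].
  + by left; apply: ltn_trans ab bg.
  + by left.
  + by left.
  + by right; split=> //; apply: (lt_mon_trans ho) ab bg.
- move=> _ _ [al _ <-] [be _ <-].
  have [ab|ba|ab] := ltngtP (deg al) (deg be).
  + by apply: Or31; apply/graded_ltE; left.
  + by apply: Or33; apply/graded_ltE; left.
  have [->|/(lt_mon_total ho)[l|l]] := eqVneq al be; first exact: Or32.
  + by apply: Or31; apply/graded_ltE; right.
  + by apply: Or33; apply/graded_ltE; right.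
move=> S SM [x0 Sx0]; have [al0 _ al0E] := SM _ Sx0.
pose degS d := `[< exists2 al, S (mon al) & deg al = d >].
have ex : exists d, degS d.
  by exists (deg al0); apply/asboolP; exists al0; rewrite ?al0E.
case: (ex_minnP ex) => d /asboolP[al1 Sal1 al1d] d_min.
have [_ _ _ wf] := ho.
have [||x [al [Sal ald] <-] al_min] :=
    wf [set mon al | al in [set al | S (mon al) /\ deg al = d]].
- by move=> _ [al _ <-]; exists al.
- by exists (mon al1), al1.
exists (mon al) => // y Sy; have [be _ beE] := SM _ Sy; subst y.
have : (d <= deg be)%N by apply: d_min; apply/asboolP; exists be.
rewrite leq_eqVlt => /orP[/eqP dE|d_be]; last first.
  by right; apply/graded_ltE; left; rewrite ald.
have [->|l] : mon al = mon be \/ lt (mon al) (mon be).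
- by apply: al_min; exists be.
- by left.
- by right; apply/graded_ltE; right; rewrite ald.
Qed.

Section Solvable.
Hypothesis hS : solvable_polynomial_algebra a lt.
Hypothesis hF : N_filtered a m.

(** The tail of the product is bounded for [lt] by solvability and in degree by
    the filtration; [span_setI] puts both bounds on the same monomials. *)
Lemma graded_leads alpha beta :
  leads graded_lt (mon alpha * mon beta) (alpha + beta).
Proof.
have [_ [ho _ _] /(mul_mon_below ho) mulP] := hS.
have [k k0 kP] := mulP alpha beta; exists k => //.
have kF : filtration a m (deg (alpha + beta))
    (mon alpha * mon beta - k *: mon (alpha + beta)).
  apply: kspanB; first by rewrite degD; apply: N_filtered_mul_mon.
  by apply/kspanZ/mem_kspan; exists (alpha + beta) => /=.
apply: kspan_sub (span_setI kP kF) => _ [b [b_ab b_deg] <-].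
apply: mem_kspan; exists b => //; apply/graded_ltE; move: b_deg => /=.
by rewrite leq_eqVlt => /orP[/eqP|]; [right | left].
Qed.

Lemma graded_lt_addr alpha beta eta :
  graded_lt (mon alpha) (mon beta) ->
  graded_lt (mon (alpha + eta)) (mon (beta + eta)).
Proof.
have [_ hm /(mul_mon_below (let: And3 ho _ _ := hm in ho)) mulP] := hS.
have [ho _ _] := hm.
move=> /graded_ltE ab; apply/graded_ltE; rewrite !degD ltn_add2r.
case: ab => [|[->]]; first by left.
by right; split=> //; apply: (lt_mon_addr ho mulP hm).
Qed.

Lemma graded_lt_monomial_ordering : monomial_ordering a graded_lt.
Proof.
have [_ [/graded_lt_well_ordering hgr _ _] _] := hS.
have LM3 := LM_mul3 hgr graded_leads graded_lt_addr.
split=> // [al be eta /=|ga al be eta /= ab _ _ _]; rewrite !LM3.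
- move=> _ _ ne; apply/graded_ltE; left.
  (* Positive weights make the degree strictly larger unless both outer
     factors are trivial. *)
  rewrite addrAC degD -[X in (X < _)%N]add0n ltn_add2r lt0n deg_eq0 //.
  apply/eqP => ae0; apply: ne; rewrite addrAC ae0.
  by congr Defs.mon; rewrite add0r.
- by rewrite ![ga + _]addrC; do 2!apply: graded_lt_addr.
Qed.

Lemma graded_lt_solvable : solvable_polynomial_algebra a graded_lt.
Proof.
split; [exact: hB | exact: graded_lt_monomial_ordering |].
have [hgr _ _] := graded_lt_monomial_ordering.
exact/(mul_mon_below hgr)/graded_leads.
Qed.

End Solvable.
End GradedOrder.
End Graded.
End PBWBasis.

Theorem proposition4p2 (K : fieldType) (A : algType K) (n : nat)
    (a : 'I_n -> A) (hB : PBW_basis a) :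
  (exists (m : 'I_n -> nat) (lt : A -> A -> Prop),
     [/\ positive_weights m,
         graded_monomial_ordering a m lt &
         solvable_polynomial_algebra a lt])
  <->
  ((exists lt : A -> A -> Prop, solvable_polynomial_algebra a lt) /\
   (exists m : 'I_n -> nat, positive_weights m /\ N_filtered a m)).
Proof.
split=> [[m [lt [m_gt0 hgr hS]]]|[[lt hS] [m [m_gt0 hF]]]].
  split; first by exists lt.
  by exists m; split=> //; apply: (graded_N_filtered hB hgr hS).
exists m, (graded_lt a m lt); split=> //; last exact: graded_lt_solvable.
split; first exact: graded_lt_monomial_ordering.
exact: graded_lt_deg.
Qed.
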